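(* Let $(F,\|\cdot\|)$ be a proper, finite, non-trivial, strictly hyperbolic, positively polarizable hyperbolically normed cone over $\mathbb{R}$, let $\langle\cdot,\cdot\rangle$ be the induced inner product on $\mathrm{span}(F)$, and let $t_*\in F$ with $\langle t_*,t_*\rangle=1$. Suppose that $\mathrm{span}(F)$ is a Lorentzian vector space, and let $\mathbf{n}$ be the norm of its Wick rotation with respect to $t_*$. If $\mathrm{span}(F)$ is sequentially forward complete with respect to the topology induced by $\mathbf{n}$ and $\mathrm{Int}(F)\ne\emptyset$ (interior in that topology), then $\mathrm{span}(F)$ is a Lorentz--Hilbert space. Conversely, if $\mathrm{span}(F)$ is a Lorentz--Hilbert space, then it is sequentially forward complete (with respect to the topology induced by $\mathbf{n}$).
   Context: A linear cone over $\mathbb{R}$ is a commutative, cancellative monoid $(F,+)$ with a scalar multiplication $[0,\infty)\times F\to F$ such that $\lambda(v+w)=\lambda v+\lambda w$, $(\lambda+\mu)v=\lambda v+\mu v$, $\lambda(\mu v)=(\lambda\mu)v$, $1v=v$. It is proper if no $v\in F\setminus\{0\}$ has an additive inverse in $F$. $\mathrm{span}(F)=(F\times F)/\sim$, with $(v_1,w_1)\sim(v_2,w_2)$ iff $v_1+w_2=v_2+w_1$, is a real vector space into which $F$ embeds via $v\mapsto[(v,0)]$; $F$ is identified with its image, and every element of $\mathrm{span}(F)$ has the form $v-w$ with $v,w\in F$. A hyperbolic norm on $F$ is a map $\|\cdot\|:F\to[0,\infty]$ with $\|v+w\|\ge\|v\|+\|w\|$ and $\|\lambda v\|=\lambda\|v\|$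 for all $v,w\in F$, $\lambda\ge0$ (convention $0\cdot\infty=0$); $(F,\|\cdot\|)$ is then a hyperbolically normed cone. It is finite if $\|v\|<\infty$ for all $v\in F$; non-trivial if $\|t\|>0$ for some $t\in F$; positively polarizable if $\|v+2w\|^2+\|v\|^2=2\|v+w\|^2+2\|w\|^2$ for all $v,w\in F$; strictly hyperbolic if $\|u+v\|=\|u\|+\|v\|$ with $u,v\in F$ implies $u=\lambda v$ or $v=\lambda u$ for some $\lambda\ge0$. An inner product is a symmetric bilinear form. The induced inner product is the unique symmetric bilinear form on $\mathrm{span}(F)$ extending $\langle v,w\rangle=\frac12(\|v+w\|^2-\|v\|^2-\|w\|^2)$, $v,w\in F$. A real vector space $V$ with an inner product is Lorentzian if $V=V_1\oplus V_2$ with $\dim V_1=1$, such that the inner product is positive definite on $V_1$ and negative definite on $V_2$. If $V$ is Lorentzian and $t\in V$ with $\langle t,t\rangle=1$, then $V=\mathbb{R}t\oplus W$, $W=(\mathbb{R}t)^\perp$, with $\langle\cdot,\cdot\rangle$ negative definite on $W$ (a Lorentz decomposition). Writing $v=\alpha_v t+w_v$ with $\alpha_v\in\mathbb{R}$, $w_v\in W$, the Wick rotation with respect to $t$ is the positive definite inner product $(v,u)=\alpha_v\alpha_u-\langle w_v,w_u\rangle$, with norm $\mathbf{n}(v)=\sqrt{(v,v)}$. $V$ is a Lorentz--Hilbert space if it is complete with respect to the Wick rotation in some Lorentz decomposition (this is independent of the decomposition). $\mathrm{span}(F)$ carries the partial order $v\le w$ iff $w-v\in F$. A topological vector space with a partial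 order is sequentially forward complete if every non-decreasing sequence $(v_j)_{j\in\mathbb{N}}$ that is bounded above (by an element of the space) converges in the space. *)

(* Defs.v *)
From HB Require Import structures.
From mathcomp Require Import all_boot all_order all_algebra.
From mathcomp Require Import ring lra.
From mathcomp Require Import all_classical all_reals all_analysis.

Set Implicit Arguments.
Unset Strict Implicit.
Unset Printing Implicit Defensive.
Import Order.TTheory GRing.Theory Num.Theory.
Import numFieldNormedType.Exports.

Local Open Scope classical_set_scope.
Local Open Scope quotient_scope.
Local Open Scope ring_scope.

(* The semiring [0, oo); a scalar multiplication [0, oo) * F -> F is then an
   [lSemiModType (nnegs R)] structure on F. *)
Record nnegs (R : realType) := NNegs {
  nnegs_val :> R;
  nnegs_valP : nnegs_val \is Num.nneg }.
HB.instance Definition _ R := [isSub for @nnegs_val R].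
HB.instance Definition _ R := [Choice of nnegs R by <:].
HB.instance Definition _ R :=
  [SubChoice_isSubComNzSemiRing of nnegs R by <:].

HB.mixin Record LSemiModule_isCancellative (R : realType) F
    of GRing.LSemiModule (nnegs R) F := {
  cone_addrI : forall v w1 w2 : F, v + w1 = v + w2 -> w1 = w2
}.

#[short(type="linearConeType")]
HB.structure Definition LinearCone (R : realType) :=
  {F of GRing.LSemiModule (nnegs R) F & LSemiModule_isCancellative R F}.

Definition proper_cone (R : realType) (F : linearConeType R) :=
  forall v w : F, v + w = 0 -> v = 0.

Section ConeSpan.
Variables (R : realType) (F : linearConeType R).
Implicit Types (p q : F * F) (v w : F).

(* span(F) = (F x F)/~ *)
Definition span_equiv : rel (F * F) := fun p q => p.1 + q.2 == q.1 + p.2.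

Lemma span_equiv_refl : reflexive span_equiv.
Proof. by move=> p; rewrite /span_equiv. Qed.

Lemma span_equiv_sym : symmetric span_equiv.
Proof. by move=> p q; rewrite /span_equiv eq_sym. Qed.

Lemma span_equiv_trans : transitive span_equiv.
Proof.
move=> [b1 b2] [a1 a2] [c1 c2]; rewrite /span_equiv /= => /eqP ab /eqP bc.
apply/eqP/(@cone_addrI _ _ (b1 + b2)).
rewrite (AC (2*2) ((3*2)*(1*4)))/= ab bc.
by rewrite (AC (2*2) ((1*4)*(3*2)))/=.
Qed.

Canonical span_equivrel :=
  EquivRel span_equiv span_equiv_refl span_equiv_sym span_equiv_trans.

Definition cone_span := {eq_quot span_equiv}.
HB.instance Definition _ : EqQuotient _ span_equiv cone_span := EqQuotient.on cone_span.
HB.instance Definition _ := Choice.on cone_span.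

Lemma span_eqP p q :
  \pi_cone_span p = \pi_cone_span q <-> p.1 + q.2 = q.1 + p.2.
Proof. by split=> [/eqmodP/eqP|h]; [|apply/eqmodP/eqP]. Qed.

Definition span_addf p q := (p.1 + q.1, p.2 + q.2).
Definition span_oppf p := (p.2, p.1).
(* a [v, w] = [a^+ v + a^- w, a^+ w + a^- v], a^+ and a^- being the positive
   and negative parts of a *)
Definition pos_part (a : R) : nnegs R := insubd 0 a.
Definition neg_part (a : R) : nnegs R := insubd 0 (- a).
Definition span_scalef (a : R) p :=
  (pos_part a *: p.1 + neg_part a *: p.2,
   pos_part a *: p.2 + neg_part a *: p.1).

Definition span_add := lift_op2 cone_span span_addf.
Definition span_opp := lift_op1 cone_span span_oppf.
Definition span_zero : cone_span := \pi_cone_span (0, 0).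
Definition span_scale (a : R) := lift_op1 cone_span (span_scalef a).

Lemma span_repr p : (repr (\pi_cone_span p)).1 + p.2 = p.1 + (repr (\pi_cone_span p)).2.
Proof. by apply/span_eqP; rewrite reprK. Qed.

Lemma span_piD p q :
  span_add (\pi_cone_span p) (\pi_cone_span q) = \pi_cone_span (p.1 + q.1, p.2 + q.2).
Proof.
unlock span_add; apply/span_eqP => /=.
by rewrite [LHS]addrACA !span_repr addrACA.
Qed.

Lemma span_piN p : span_opp (\pi_cone_span p) = \pi_cone_span (p.2, p.1).
Proof. by unlock span_opp; apply/span_eqP => /=; rewrite addrC -span_repr addrC. Qed.

Lemma span_piZ (a : R) p (b c : nnegs R) : a = val b - val c ->
  span_scale a (\pi_cone_span p) = \pi_cone_span (b *: p.1 + c *: p.2, b *: p.2 + c *: p.1).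
Proof.
move=> abc; unlock span_scale; set r := repr (\pi_cone_span p).
have part_a : pos_part a + c = b + neg_part a.
  apply: val_inj; rewrite /= !val_insubd !qualifE/= abc.
  rewrite -![nnegs_val _]/(val _).
  by case: (leP 0 (val b - val c)); case: (leP 0 (- (val b - val c))) => /=; lra.
transitivity (\pi_cone_span (b *: r.1 + c *: r.2, b *: r.2 + c *: r.1)).
  apply/span_eqP => /=.
  rewrite (AC (2*2) ((1*4)*(2*3)))/= -!scalerDl part_a.
  by rewrite (addrC _ b) -{2}part_a !scalerDl (AC (2*2) ((1*4)*(3*2)))/=.
apply/span_eqP => /=.
rewrite (AC (2*2) ((1*3)*(2*4)))/= -!scalerDr (addrC r.2).
have rp : r.1 + p.2 = p.1 + r.2 by exact: span_repr.
by rewrite rp -{2}rp !scalerDr (AC (2*2) ((1*4)*(2*3))).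
Qed.

Lemma span_addA : associative span_add.
Proof.
by elim/quotW=> x; elim/quotW=> y; elim/quotW=> z; rewrite !span_piD/= !addrA.
Qed.

Lemma span_addC : commutative span_add.
Proof.
by elim/quotW=> x; elim/quotW=> y; rewrite !span_piD; congr (\pi_cone_span (_, _));
  exact: addrC.
Qed.

Lemma span_add0 : left_id span_zero span_add.
Proof. by elim/quotW=> -[x1 x2]; rewrite span_piD/= !add0r. Qed.

Lemma span_addN : left_inverse span_zero span_opp span_add.
Proof.
elim/quotW=> x; rewrite span_piN span_piD; apply/span_eqP => /=.
by rewrite addr0 add0r addrC.
Qed.

HB.instance Definition _ :=
  GRing.isZmodule.Build cone_span span_addA span_addC span_add0 span_addN.

Lemma span_partE (c : R) : c = val (pos_part c) - val (neg_part c).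
Proof.
rewrite !val_insubd !qualifE/=.
by case: (leP 0 c); case: (leP 0 (- c)) => /=; lra.
Qed.

Lemma span_scaleA a b (x : cone_span) :
  span_scale a (span_scale b x) = span_scale (a * b) x.
Proof.
elim/quotW: x => x; rewrite (span_piZ x (span_partE b)) (span_piZ _ (span_partE a)).
rewrite (@span_piZ _ _ (pos_part a * pos_part b + neg_part a * neg_part b)
  (pos_part a * neg_part b + neg_part a * pos_part b)).
  congr (\pi_cone_span (_, _)) => /=.
    by rewrite !scalerDr !scalerA !scalerDl (AC (2*2) ((1*4)*(2*3))).
  by rewrite !scalerDr !scalerA !scalerDl (AC (2*2) ((1*4)*(2*3))).
by rewrite {1}(span_partE a) {1}(span_partE b) /=; ring.
Qed.

Lemma span_scale1 : left_id 1 span_scale.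
Proof.
elim/quotW=> -[x1 x2]; rewrite (@span_piZ _ _ 1 0) ?subr0//=.
by rewrite !scale1r !scale0r !addr0.
Qed.

Lemma span_scaleDr : right_distributive span_scale +%R.
Proof.
move=> a; elim/quotW=> x; elim/quotW=> y.
rewrite [in LHS]/GRing.add/= span_piD !(span_piZ _ (span_partE a)).
rewrite [in RHS]/GRing.add/= span_piD.
by congr (\pi_cone_span (_, _)) => /=; rewrite !scalerDr addrACA.
Qed.

Lemma span_scaleDl x : {morph span_scale^~ x : a b / a + b}.
Proof.
move=> a b; elim/quotW: x => x.
rewrite (span_piZ x (span_partE a)) (span_piZ x (span_partE b)).
rewrite (@span_piZ _ _ (pos_part a + pos_part b) (neg_part a + neg_part b)).
  rewrite [in RHS]/GRing.add/= span_piD.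
  by congr (\pi_cone_span (_, _)) => /=; rewrite !scalerDl addrACA.
by rewrite {1}(span_partE a) {1}(span_partE b) /=; ring.
Qed.

HB.instance Definition _ := GRing.Zmodule_isLmodule.Build R cone_span
  span_scaleA span_scale1 span_scaleDr span_scaleDl.

Definition cone_in v : cone_span := \pi_cone_span (v, 0).

Definition in_cone : set cone_span := range cone_in.

Definition span_le (x y : cone_span) := in_cone (y - x).

Lemma cone_in_inj : injective cone_in.
Proof. by move=> v w /span_eqP /=; rewrite !addr0. Qed.

Lemma cone_inD : {morph cone_in : v w / v + w}.
Proof. by move=> v w; rewrite [in RHS]/GRing.add/= span_piD /= addr0. Qed.

Lemma cone_inZ (a : nnegs R) v : cone_in (a *: v) = val a *: cone_in v.
Proof.
by rewrite /GRing.scale/= (@span_piZ _ _ a 0) ?subr0//= !scaler0 scale0r !addr0.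
Qed.

Lemma span_coneB (x : cone_span) : exists v w, x = cone_in v - cone_in w.
Proof.
elim/quotW: x => -[v w]; exists v, w.
rewrite /GRing.opp/= span_piN /GRing.add/= span_piD/=.
by rewrite addr0 add0r.
Qed.

End ConeSpan.

Section HyperbolicNorm.
Variables (R : realType) (F : linearConeType R) (N : F -> \bar R).
Local Open Scope ereal_scope.

Definition hyperbolic_norm :=
  [/\ forall v, 0 <= N v,
      forall v w, N v + N w <= N (v + w)%R &
      forall (a : nnegs R) v, N (a *: v)%R = (val a)%:E * N v].

Definition finite_hnorm := forall v, N v < +oo.

Definition nontrivial_hnorm := exists t, 0 < N t.

Definition positively_polarizable := forall v w,
  N (v + 2 *: w)%R ^+ 2 + N v ^+ 2 = 2%:E * N (v + w)%R ^+ 2 + 2%:E * N w ^+ 2.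

Definition strictly_hyperbolic := forall u v, N (u + v)%R = N u + N v ->
  exists a : nnegs R, u = (a *: v)%R \/ v = (a *: u)%R.

(* For finite N; [b] is then unique, since F generates [cone_span F]. *)
Definition induced_inner_product (b : {symmetric (cone_span F)}) := forall v w : F,
  b (cone_in v) (cone_in w) =
    ((fine (N (v + w)%R) ^+ 2 - fine (N v) ^+ 2 - fine (N w) ^+ 2) / 2)%R.

End HyperbolicNorm.

(* V = V1 (+) V2 with dim V1 = 1; V2 may be infinite dimensional. *)
Definition lorentzian (R : realType) (V : lmodType R) (b : {symmetric V}) :=
  exists V1 V2 : {pred V},
    [/\ submod_closed V1 /\ submod_closed V2,
        (forall v, exists v1 v2, [/\ v1 \in V1, v2 \in V2 & v = v1 + v2]) /\
          (forall v, v \in V1 -> v \in V2 -> v = 0),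
        exists2 e, e != 0 & forall v, (v \in V1) <-> (exists a : R, v = a *: e),
        {in V1, forall v, v != 0 -> 0 < b v v} &
        {in V2, forall v, v != 0 -> b v v < 0}].

Section Wick.
Variables (R : realType) (V : lmodType R) (b : {symmetric V}) (t : V).

(* v = b v t *: t + (v - b v t *: t) is the decomposition of v along
   V = Rt (+) t^perp when b t t = 1, see [wick_decomp]. *)
Definition wick v u : R :=
  b v t * b u t - b (v - b v t *: t) (u - b u t *: t).

Definition wick_norm v : R := Num.sqrt (wick v v).

Hypotheses (hL : lorentzian b) (ht : b t t = 1).

Lemma symE u v : b u v = b v u.
Proof. by rewrite hermC expr0 mul1r. Qed.

Lemma symDl u v w : b (u + v) w = b u w + b v w.
Proof. exact: linearDl. Qed.

Lemma symDr u v w : b w (u + v) = b w u + b w v.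
Proof. exact: linearDr. Qed.

Lemma symBl u v w : b (u - v) w = b u w - b v w.
Proof. exact: linearBl. Qed.

Lemma symBr u v w : b w (u - v) = b w u - b w v.
Proof. exact: linearBr. Qed.

Lemma symZl a u v : b (a *: u) v = a * b u v.
Proof. exact: linearZl_LR. Qed.

Lemma symZr a u v : b u (a *: v) = a * b u v.
Proof. by rewrite symE symZl symE. Qed.

Lemma wick_decomp (a : R) v w : v = a *: t + w -> b w t = 0 ->
  a = b v t /\ w = v - b v t *: t.
Proof.
move=> -> wt; suff -> : b (a *: t + w) t = a by rewrite addrAC subrr add0r.
by rewrite symDl symZl ht wt mulr1 addr0.
Qed.

Lemma wickE v u : wick v u = 2 * b v t * b u t - b v u.
Proof.
rewrite /wick !(symBl, symBr, symZl, symZr).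
by rewrite ht (symE t u); ring.
Qed.

Lemma orth_neg w : b w t = 0 -> w != 0 -> b w w < 0.
Proof.
have [V1 [V2 [[_ [V20 V2D]] [dec _] [e e0 V1e] pos neg]]] := hL.
move=> wt w0; rewrite ltNge; apply/negP => ww.
have tV2 : t \notin V2.
  apply/negP => /neg; have t0 : t != 0.
    apply/eqP => t0; move: ht.
    by rewrite t0 linear0r => /esym/eqP; rewrite oner_eq0.
  by rewrite ht ltNge ler01 => /(_ t0).
have [_ [v [/V1e[a ->] vV tE]]] := dec t.
have [_ [u [/V1e[c ->] uV wE]]] := dec w.
have V2x : c *: t - a *: w \in V2.
  have -> : c *: t - a *: w = c *: v + (- a *: u + 0).
    rewrite [in LHS]tE [in LHS]wE !scalerDr !scalerA (mulrC c a).
    by rewrite opprD addrACA subrr add0r addr0 scaleNr.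
  by apply: (V2D) => //; exact: V2D.
have bx : b (c *: t - a *: w) (c *: t - a *: w) = c ^+ 2 + a ^+ 2 * b w w.
  rewrite !(symBl, symBr, symZl, symZr).
  by rewrite ht (symE t w) wt; ring.
have [x0|x0] := eqVneq (c *: t - a *: w) 0; last first.
  have := neg _ V2x x0; rewrite bx ltNge => /negP; apply.
  by rewrite addr_ge0 ?sqr_ge0// mulr_ge0 ?sqr_ge0.
have c0 : c = 0.
  have : b (c *: t - a *: w) t = 0 by rewrite x0 linear0l.
  by rewrite symBl !symZl ht wt mulr0 mulr1 subr0.
move: x0; rewrite c0 scale0r sub0r => /eqP.
rewrite oppr_eq0 scaler_eq0 (negbTE w0) orbF => /eqP a0.
by move: tV2; rewrite tE a0 scale0r add0r vV.
Qed.

Lemma wick_ge0 v : 0 <= wick v v.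
Proof.
rewrite /wick -expr2 addr_ge0 ?sqr_ge0// oppr_ge0.
have [->|w0] := eqVneq (v - b v t *: t) 0; first by rewrite linear0l.
apply/ltW/orth_neg => //.
by rewrite symBl symZl ht mulr1 subrr.
Qed.

Lemma wick_eq0 v : wick v v = 0 -> v = 0.
Proof.
have wt : b (v - b v t *: t) t = 0.
  by rewrite symBl symZl ht mulr1 subrr.
rewrite /wick -expr2; have [w0|w0] := eqVneq (v - b v t *: t) 0.
  rewrite w0 linear0l subr0 => /eqP; rewrite sqrf_eq0 => /eqP a0.
  by move: w0; rewrite a0 scale0r subr0.
move=> /eqP; rewrite subr_eq0 => /eqP wv.
by have := orth_neg wt w0; rewrite -wv ltNge sqr_ge0.
Qed.

Lemma wick_cauchy_schwarz u v : wick u v ^+ 2 <= wick u u * wick v v.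
Proof.
have quad s : wick (u + s *: v) (u + s *: v) =
    wick u u + s * wick u v *+ 2 + s ^+ 2 * wick v v.
  rewrite !wickE !(symDl, symDr, symZl, symZr).
  by rewrite (symE v u) mulr2n; ring.
have [/eqP|v0] := eqVneq (wick v v) 0.
  move=> /eqP/wick_eq0 ->; rewrite (_ : wick u 0 = 0) ?expr0n ?mulr_ge0 ?wick_ge0//.
  by rewrite wickE linear0l !linear0r; ring.
have v_gt0 : 0 < wick v v by rewrite lt_def v0 wick_ge0.
have := wick_ge0 (u + (- (wick u v / wick v v)) *: v); rewrite quad.
have -> : wick u u + - (wick u v / wick v v) * wick u v *+ 2 +
    (- (wick u v / wick v v)) ^+ 2 * wick v v =
    (wick u u * wick v v - wick u v ^+ 2) / wick v v.
  by rewrite mulr2n; field.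
by rewrite pmulr_lge0 ?invr_gt0// subr_ge0.
Qed.

Lemma wick_normD u v : wick_norm (u + v) <= wick_norm u + wick_norm v.
Proof.
rewrite -(@ler_pXn2r _ 2) ?nnegrE ?addr_ge0 ?sqrtr_ge0//.
rewrite sqr_sqrtr ?wick_ge0// sqrrD !sqr_sqrtr ?wick_ge0//.
have -> : wick (u + v) (u + v) = wick u u + wick u v *+ 2 + wick v v.
  by rewrite !wickE !(symDl, symDr) (symE v u) mulr2n; ring.
rewrite lerD2r lerD2l lerMn2r/= -sqrtrM ?wick_ge0//.
by rewrite (le_trans (ler_norm _))// -sqrtr_sqr ler_wsqrtr// wick_cauchy_schwarz.
Qed.

Lemma wick_normZ (a : R) v : wick_norm (a *: v) = `|a| * wick_norm v.
Proof.
rewrite /wick_norm (_ : wick _ _ = a ^+ 2 * wick v v).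
  by rewrite sqrtrM ?sqr_ge0// sqrtr_sqr.
by rewrite !wickE !(symZl, symZr); ring.
Qed.

Lemma wick_norm_eq0 v : wick_norm v = 0 -> v = 0.
Proof.
move=> /eqP; rewrite sqrtr_eq0 => v0.
by apply/wick_eq0/eqP; rewrite eq_le v0 wick_ge0.
Qed.

End Wick.

(* The normed space (V, n), n being the norm of the Wick rotation of [b] with
   respect to [t]. *)
Definition wick_space (R : realType) (V : lmodType R) (b : {symmetric V})
  (t : V) (hL : lorentzian b) (ht : b t t = 1) : Type := V.

Section WickSpace.
Variables (R : realType) (V : lmodType R) (b : {symmetric V}) (t : V).
Variables (hL : lorentzian b) (ht : b t t = 1).

HB.instance Definition _ := GRing.Lmodule.copy (wick_space hL ht) V.
HB.instance Definition _ := Lmodule_isNormed.Build R (wick_space hL ht)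
  (wick_normD hL ht) (wick_normZ ht) (wick_norm_eq0 hL ht).

Lemma wick_space_normE (v : wick_space hL ht) : `|v| = wick_norm b t v.
Proof. by []. Qed.

End WickSpace.

Definition complete_space (T : puniformType) :=
  forall G : set_system T, ProperFilter G -> cauchy G -> cvg G.

Definition lorentz_hilbert (R : realType) (V : lmodType R)
    (b : {symmetric V}) :=
  exists (hL : lorentzian b) (t : V) (ht : b t t = 1),
    complete_space (wick_space hL ht).

Definition sequentially_forward_complete (T : ptopologicalType)
    (le : T -> T -> Prop) :=
  forall u : nat -> T, {homo u : m n / (m <= n)%N >-> le m n} ->
    (exists x, forall n, le (u n) x) -> cvgn u.

(* Main.v *)
Require Import Defs.
From mathcomp Require Import all_boot all_order all_algebra.
From mathcomp Require Import ring lra.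
From mathcomp Require Import all_classical all_reals all_analysis.
Import Order.TTheory GRing.Theory Num.Theory.
Import numFieldNormedType.Exports.
Local Open Scope classical_set_scope.
Local Open Scope ring_scope.

(** A subset [C] of a normed space defines the relation [C (y - x)] between
    [x] and [y]; for a convex cone this is an order, and the theorem compares
    completeness of the norm with convergence of monotone bounded sequences.

    Forward complete implies complete: if the cone [C] contains a ball of radius
    [r] around [p], then by homogeneity it contains the ball of radius [a r]
    around [a p] for all [a > 0]. A Cauchy sequence with steps of order [2^-n]
    therefore becomes increasing once a multiple of [2^-n p] is subtracted from
    its [n]-th term, and it is bounded above because every bounded set lies
    below a large multiple of [p]. The corrections tend to [0], so the original
    sequence converges together with the corrected one
    ([forward_complete_complete]).

    Complete implies forward complete: the reversed triangle inequality gives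
    [<v, v> >= 0] and [<v, w> >= 0] for [v, w] in the cone, so the Wick norm of
    [v] is at most [2 <v, t>] there ([wick_norm_cone]). Along an increasing
    bounded sequence the real numbers [<u n, t>] increase and stay bounded, and
    they control the norms of the increments of [u], which is hence Cauchy
    ([complete_forward_complete]).

    A Lorentz-Hilbert space is only assumed complete for some unit timelike
    vector [t'], which need not lie in the cone. The Wick norms of [t] and [t']
    are equivalent, since [|<v, t>|] is bounded by the product of the Wick norms
    of [v] and [t] with respect to [t'] ([wick_norm_equiv]), so completeness
    carries over to [t] ([wick_complete_indep]). *)

(** * Order completeness and metric completeness *)

Section ConeOrder.
Context {R : realType} {V : normedModType R}.
Variable C : set V.

Lemma cone_ball (p : V) (r : R) :
  (forall (a : R) v, 0 < a -> C v -> C (a *: v)) ->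
  (forall v, `|v - p| < r -> C v) ->
  forall (a : R) z, 0 < a -> `|z| < a * r -> C (a *: p + z).
Proof.
move=> CZ Cp a z a0 za.
have -> : a *: p + z = a *: (p + a^-1 *: z).
  by rewrite scalerDr scalerA mulfV ?gt_eqF// scale1r.
apply: CZ => //; apply: Cp.
rewrite addrAC subrr add0r normrZ gtr0_norm ?invr_gt0//.
by rewrite mulrC ltr_pdivrMr// mulrC.
Qed.

(** Completeness may be tested on sequences with summable steps: such a
    sequence is extracted from a Cauchy filter by choosing balls of radius
    [2^-n] that belong to the filter. *)
Lemma complete_of_fast_sequences :
  (forall x : nat -> V,
    (forall m n, `|x m - x n| < 2^-1 ^+ m + 2^-1 ^+ n) -> cvgn x) ->
  complete_space V.
Proof.
move=> fast G GF cG.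
have h0 n : 0 < 2^-1 ^+ n :> R by rewrite exprn_gt0// invr_gt0.
have xP n : exists x : V, G (ball x (2^-1 ^+ n)).
  by have [x] := (cauchyP _).1 cG _ (h0 n); exists x.
have [x {}xP] := choice xP.
have /fast/cvg_ex[l xl] : forall m n, `|x m - x n| < 2^-1 ^+ m + 2^-1 ^+ n.
  move=> m n; have [y []] := filter_ex (filterI (xP m) (xP n)).
  rewrite -!ball_normE /= => ym yn.
  rewrite -(subrKA y) (le_lt_trans (ler_normD _ _))// ltrD//.
  by rewrite distrC.
apply/cvg_ex; exists l; apply/cvg_ballP => e e0.
have e2 : 0 < e / 2 by rewrite divr_gt0.
have hn : (GRing.exp (2^-1 : R) : nat -> R) @ \oo --> (0 : R).
  by apply: cvg_expr; rewrite gtr0_norm ?invr_gt0// invf_lt1// ltr1n.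
have [n [/= nl ne]] : exists n, `|l - x n| < e / 2 /\ 2^-1 ^+ n < e / 2.
  have [n [/= ?]] :=
    filter_ex (filterI (cvgr_dist_lt _ _ xl _ e2) (cvgr_dist_lt _ _ hn _ e2)).
  rewrite sub0r normrN gtr0_norm// => ?.
  by exists n.
apply: filterS (xP n) => y; rewrite -!ball_normE /= => ny.
rewrite -(subrKA (x n)) (le_lt_trans (ler_normD _ _))// [ltRHS]splitr ltrD//.
exact: lt_trans ny ne.
Qed.

Lemma forward_complete_complete :
  C 0 -> (forall v w, C v -> C w -> C (v + w)) ->
  (forall (a : R) v, 0 < a -> C v -> C (a *: v)) ->
  (interior C) !=set0 ->
  sequentially_forward_complete (fun x y : V => C (y - x)) ->
  complete_space V.
Proof.
move=> C0 CD CZ [p /nbhs_ballP[r /= r0 pr]] sfc.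
have {pr}Cball : forall (a : R) z, 0 < a -> `|z| < a * r -> C (a *: p + z).
  by apply: cone_ball => // v vp; apply: pr; rewrite -ball_normE /= distrC.
apply: complete_of_fast_sequences => x xP.
have h0 n : 0 < 2^-1 ^+ n :> R by rewrite exprn_gt0// invr_gt0.
have h1 n : 2^-1 ^+ n <= 1 :> R by rewrite exprn_ile1// invf_le1// ler1n.
(* With the factor 4 the increments of [y] are of the form [s p + z], where
   [s = (2 / r) 2^-n] and [|z| < (3/2) 2^-n < s r]. *)
pose a n : R := 4 / r * 2^-1 ^+ n.
pose y n := x n - a n *: p.
have a0 n : 0 < a n by rewrite !mulr_gt0// invr_gt0.
have ar n : a n * r = 4 * 2^-1 ^+ n by rewrite /a mulrAC divfK ?gt_eqF.
have y_incr : {homo y : m n / (m <= n)%N >-> C (n - m)}.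
  apply: (homo_leq (r := fun u v : V => C (v - u))).
  - by move=> u; rewrite subrr.
  - by move=> v u w uv vw; rewrite -(subrKA v) addrC; apply: CD; rewrite // addrC.
  move=> n; have -> : y n.+1 - y n = (a n - a n.+1) *: p + (x n.+1 - x n).
    by rewrite /y opprB scalerBl (AC (2*2) ((3*2)*(1*4)))/=.
  have aS : a n.+1 = a n / 2 by rewrite /a exprSr mulrA.
  apply: Cball; first by rewrite aS; have := a0 n; lra.
  apply: (lt_le_trans (xP _ _)); rewrite mulrBl !ar exprSr.
  by have := h0 n; lra.
have y_bounded : exists b, forall n, C (b - y n).
  (* All terms of [x] are within distance 2 of [x 0]. *)
  exists (x 0 + (2 / r) *: p) => n.
  have -> : x 0 + (2 / r) *: p - y n = (2 / r + a n) *: p + (x 0 - x n).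
    by rewrite /y opprB scalerDl (AC (2*2) ((2*3)*(1*4)))/=.
  have r20 : 0 < 2 / r by rewrite divr_gt0.
  apply: Cball; first by rewrite addr_gt0.
  apply: (lt_le_trans (xP _ _)); rewrite mulrDl ar divfK ?gt_eqF//.
  by have := h1 n; have := h0 n; rewrite expr0; lra.
have /cvg_ex[l yl] := sfc y y_incr y_bounded.
have acvg : a n @[n --> \oo] --> (0 : R).
  rewrite -(mulr0 (4 / r)); apply: cvgMr; apply: cvg_expr.
  by rewrite gtr0_norm ?invr_gt0// invf_lt1// ltr1n.
have -> : x = fun n => y n + a n *: p by apply/funext => n; rewrite /y subrK.
apply/cvg_ex; exists (l + 0 *: p); apply: cvgD => //.
exact: cvgZr_tmp.
Qed.

(** The functional [f] turns monotone bounded sequences into monotone bounded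
    real sequences, and on [C] it controls the norm. *)
Lemma complete_forward_complete (f : V -> R) :
  {morph f : u v / u - v} -> (forall v, C v -> `|v| <= f v) ->
  complete_space V ->
  sequentially_forward_complete (fun x y : V => C (y - x)).
Proof.
move=> fB fC Vc u u_incr [x ux].
have fle v w : C (w - v) -> f v <= f w.
  by move=> vw; rewrite -subr_ge0 -fB (le_trans _ (fC _ vw)).
have fu : nondecreasing_seq (f \o u) by move=> m n /u_incr/fle.
have fcv : cvgn (f \o u).
  apply: nondecreasing_is_cvgn => //; exists (f x) => _ [n _ <-].
  exact/fle.
apply: Vc; apply: cauchy_exP => e e0.
have [m /= fm] := filter_ex (cvgr_dist_lt _ _ fcv _ e0).
exists (u m); exists m => // n /= mn.
rewrite -ball_normE /= distrC (le_lt_trans (fC _ (u_incr _ _ mn)))//.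
rewrite fB (le_lt_trans _ fm)// (le_trans _ (ler_norm _))// lerB//.
exact: (nondecreasing_cvgn_le fu fcv n).
Qed.

End ConeOrder.

(** * Independence of the Wick rotation *)

Section WickEquivalence.
Context {R : realType} {V : lmodType R} {b : {symmetric V}}.
Hypothesis hL : lorentzian b.

(** [b u v] is the Wick product of [u] with the image of [v] under the
    reflection that fixes the time axis and negates its orthogonal complement;
    the reflection preserves the Wick norm. *)
Lemma ip_le_wick (s : V) (hs : b s s = 1) u v :
  b u v ^+ 2 <= wick b s u u * wick b s v v.
Proof.
set v' := 2 * b v s *: s - v.
have sE := symE b.
have -> : b u v = wick b s u v'.
  rewrite wickE// /v' !(symBl, symBr, symZl, symZr) hs; ring.
have -> : wick b s v v = wick b s v' v'.
  rewrite !wickE// /v' !(symBl, symBr, symZl, symZr) hs (sE s v); ring.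
exact: wick_cauchy_schwarz.
Qed.

Lemma wick_norm_equiv (s t : V) : b s s = 1 -> b t t = 1 ->
  exists2 c : R, 0 < c & forall v, wick_norm b t v <= c * wick_norm b s v.
Proof.
move=> hs ht; have s0 v : 0 <= wick b s v v by exact: wick_ge0.
set k := 2 * wick b s t t + 1.
have k0 : 0 < k by rewrite /k; have := s0 t; lra.
exists (Num.sqrt k) => [|v]; first by rewrite sqrtr_gt0.
rewrite /wick_norm -sqrtrM ?(ltW k0)// ler_wsqrtr//.
rewrite wickE// -mulrA -expr2.
have vt := ip_le_wick _ hs v t.
have vv : - b v v <= wick b s v v.
  by rewrite wickE// -mulrA -expr2; have := sqr_ge0 (b v s); lra.
by rewrite /k; lra.
Qed.

Lemma wick_complete_indep (s t : V) (hL' : lorentzian b)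
    (hs : b s s = 1) (ht : b t t = 1) :
  complete_space (wick_space hL' hs) -> complete_space (wick_space hL ht).
Proof.
move=> sc G GF /(cauchyP _).1 cG.
have [c c0 ts] := wick_norm_equiv _ _ hs ht.
have [d d0 st] := wick_norm_equiv _ _ ht hs.
have [|l Gl] := (cvg_ex _).1 (sc G GF _).
  apply: cauchy_exP => e e0; have [x Gx] := cG _ (divr_gt0 e0 d0).
  exists x; apply: filterS Gx => y; rewrite -!ball_normE /= => xy.
  by rewrite (le_lt_trans (st _))// mulrC -ltr_pdivlMr.
apply/cvg_ex; exists l; apply/cvg_ballP => e e0.
have Gb : G (ball (l : wick_space hL' hs) (e / c)).
  exact: ((cvg_ballP _ _).1 Gl _ (divr_gt0 e0 c0)).
apply: (@filterS _ G _ _ _ _ Gb) => y; rewrite -!ball_normE /= => xy.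
by rewrite (le_lt_trans (ts _))// mulrC -ltr_pdivlMr.
Qed.

End WickEquivalence.

(** * The cone inside its span *)

Section InducedProduct.
Context {R : realType} {F : linearConeType R} {N : F -> \bar R}
  {ip : {symmetric (cone_span F)}}.

Lemma in_cone0 : in_cone (0 : cone_span F).
Proof. by exists 0. Qed.

Lemma in_coneD (v w : cone_span F) : in_cone v -> in_cone w -> in_cone (v + w).
Proof. by move=> [x _ <-] [y _ <-]; exists (x + y); rewrite ?cone_inD. Qed.

Lemma in_coneZ (a : R) (v : cone_span F) :
  0 < a -> in_cone v -> in_cone (a *: v).
Proof.
move=> a0 [x _ <-]; have an : a \is Num.nneg by rewrite nnegrE ltW.
by exists (NNegs an *: x); rewrite ?cone_inZ.
Qed.

Hypotheses (N_hyp : hyperbolic_norm N) (N_finite : finite_hnorm N)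
  (ip_ind : induced_inner_product N ip).

(** The reversed triangle inequality, squared, is the reversed Cauchy-Schwarz
    inequality [<v, w> >= |v| |w|]. *)
Lemma ip_cone_ge0 (v w : F) : 0 <= ip (cone_in v) (cone_in w).
Proof.
have [N0 ND _] := N_hyp.
have Nfin u : N u \is a fin_num by rewrite ge0_fin_numE.
have n0 u : 0 <= fine (N u) by rewrite fine_ge0.
have nD : fine (N v) + fine (N w) <= fine (N (v + w)).
  by rewrite -lee_fin EFinD !fineK.
rewrite ip_ind divr_ge0// -addrA -opprD subr_ge0.
have /le_trans : fine (N v) ^+ 2 + fine (N w) ^+ 2 <=
    (fine (N v) + fine (N w)) ^+ 2.
  by rewrite sqrrD lerD2r lerDl mulrn_wge0// mulr_ge0.
by apply; rewrite ler_pXn2r// nnegrE// addr_ge0.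
Qed.

Lemma wick_norm_cone (t : F) (ht : ip (cone_in t) (cone_in t) = 1)
    (v : cone_span F) :
  in_cone v -> wick_norm ip (cone_in t) v <= 2 * ip v (cone_in t).
Proof.
move=> [x _ <-]; have xt := ip_cone_ge0 x t; have xx := ip_cone_ge0 x x.
rewrite /wick_norm -(@ger0_norm _ (2 * _)) ?mulr_ge0// -sqrtr_sqr ler_wsqrtr//.
rewrite wickE//; set a := ip _ (cone_in t) in xt *.
by have := mulr_ge0 xt xt; rewrite exprMn; lra.
Qed.

End InducedProduct.

Theorem theorem3p34 (R : realType) (F : linearConeType R) (N : F -> \bar R)
    (N_hyp : hyperbolic_norm N) (F_proper : proper_cone F)
    (N_finite : finite_hnorm N) (N_nontriv : nontrivial_hnorm N)
    (N_strict : strictly_hyperbolic N) (N_polar : positively_polarizable N)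
    (ip : {symmetric (cone_span F)}) (ip_ind : induced_inner_product N ip)
    (t : F) (ht : ip (cone_in t) (cone_in t) = 1) (hL : lorentzian ip) :
  let E := wick_space hL ht in
  (@sequentially_forward_complete E (@span_le R F) ->
   @interior E (@in_cone R F) !=set0 ->
   lorentz_hilbert ip) /\
  (lorentz_hilbert ip -> @sequentially_forward_complete E (@span_le R F)).
Proof.
move=> E; split=> [sfc intF|[hL' [s [hs sc]]]].
  exists hL, (cone_in t), ht.
  apply: (@forward_complete_complete R E (@in_cone R F)) => //.
  - exact: in_cone0.
  - exact: in_coneD.
  - exact: in_coneZ.
apply: (@complete_forward_complete R E (@in_cone R F)
  (fun v => 2 * ip v (cone_in t))).
- by move=> u v; rewrite -mulrBr -symBl.
- by move=> v; apply: (wick_norm_cone N_hyp N_finite ip_ind).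
exact: wick_complete_indep sc.
Qed.
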